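(* Let $D$ be a signed digraph on $[n]$ having at least one non-negative cycle, let $\gamma^+$ be its non-negative girth, and let $s\ge2$. For any $f\in F(D,s)$, any two distinct elements of $\mathrm{Fix}(f)$ are at Hamming distance at least $\gamma^+$. Thus \[ g(D,s)\le\log_s A_{\mathrm H}(n,\gamma^+,s). \] Moreover, if $D$ is negative (all arcs have sign $-1$), then \[ g(D,s)\le\log_s A_{\mathrm m}\!\left(n,\frac{\gamma^+}{2},s\right); \] and if $D$ is positive (all arcs have sign $+1$), then \[ g(D,s)\le\log_s A_{\mathrm M}(n,\gamma^+,s). \]
   Context: A signed digraph on $[n]=\{0,\dots,n-1\}$ is $D=([n],E,\lambda)$ with $E\subseteq[n]\times[n]$ (loops allowed) and $\lambda:E\to\{-1,0,1\}$. For $i\in[n]$, $N^\alpha(i)=\{j:(j,i)\in E,\lambda(j,i)=\alpha\}$ and $N(i)$ is their union. $[s]=\{0,\dots,s-1\}$. $F(D,s)$ is the set of maps $f:[s]^n\to[s]^n$ such that each $f_i$ depends only on $x_{N(i)}$, is non-decreasing in $x_j$ when $\lambda(j,i)=1$ and non-increasing in $x_j$ when $\lambda(j,i)=-1$; $\mathrm{Fix}(f)$ is the set of fixed points and $g(D,s)=\max_{f\in F(D,s)}\log_s|\mathrm{Fix}(f)|$. A cycle is a directed cycle (loops count as cycles of length 1), its sign is the product of the signs of its arcs, it is non-negative if this product is $\ge0$, and the non-negative girth $\gamma^+$ is the minimum length of a non-negative cycle. For $x,y\in[s]^n$ let $L(x,y)=|\{i:x_i<y_i\}|$, $d_{\mathrm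 H}(x,y)=L(x,y)+L(y,x)$ (Hamming distance), $d_{\mathrm M}(x,y)=\max\{L(x,y),L(y,x)\}$, $d_{\mathrm m}(x,y)=\min\{L(x,y),L(y,x)\}$. For $\mu\in\{\mathrm H,\mathrm M,\mathrm m\}$, $A_\mu(n,d,s)$ is the maximum cardinality of a set $\mathcal C\subseteq[s]^n$ with $d_\mu(c,c')\ge d$ for all distinct $c,c'\in\mathcal C$. *)

(* Defs.v *)
From HB Require Import structures.
From mathcomp Require Import all_boot all_order all_algebra.
From mathcomp Require Import all_classical all_reals all_analysis.
Set Implicit Arguments.
Unset Strict Implicit.
Unset Printing Implicit Defensive.
Import Order.TTheory GRing.Theory Num.Theory.
Local Open Scope ring_scope.

(** The value [sign i j] is meaningful only when [arc i j] holds; every use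
    below is guarded by [arc]. *)
Record sdigraph (n : nat) := SDigraph {
  arc : rel 'I_n;
  sign : 'I_n -> 'I_n -> int;
  sign_range : forall i j, arc i j -> sign i j \in [:: -1; 0; 1]
}.

Definition nbr n (D : sdigraph n) (a : int) (i : 'I_n) : {set 'I_n} :=
  [set j | arc D j i & sign D j i == a].

Definition in_nbr n (D : sdigraph n) (i : 'I_n) : {set 'I_n} :=
  nbr D (-1) i :|: nbr D 0 i :|: nbr D 1 i.

Definition negative n (D : sdigraph n) : Prop :=
  forall i j, arc D i j -> sign D i j = -1.

Definition positive n (D : sdigraph n) : Prop :=
  forall i j, arc D i j -> sign D i j = 1.

(** A directed cycle is listed by its distinct vertices, so that its length is
    the size of the list and a loop is a one-element list. *)
Definition dicycle n (D : sdigraph n) (c : seq 'I_n) : bool :=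
  (c != [::]) && ucycleb (arc D) c.

Definition cycle_sign n (D : sdigraph n) (c : seq 'I_n) : int :=
  \prod_(i <- c) sign D i (next c i).

Definition nonneg_cycle n (D : sdigraph n) (c : seq 'I_n) : bool :=
  dicycle D c && (0 <= cycle_sign D c).

Definition nonneg_cycle_length n (D : sdigraph n) (k : nat) : bool :=
  [exists c : k.-tuple 'I_n, nonneg_cycle D c].

Lemma has_nonneg_cycle_length n (D : sdigraph n) :
  (exists c, nonneg_cycle D c) -> exists k, nonneg_cycle_length D k.
Proof. by case=> c cP; exists (size c); apply/existsP; exists (in_tuple c). Qed.

Definition nonneg_girth n (D : sdigraph n)
    (hD : exists c, nonneg_cycle D c) : nat :=
  ex_minn (has_nonneg_cycle_length hD).

Definition config (n s : nat) := {ffun 'I_n -> 'I_s}.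

Definition depends_on n s (h : config n s -> 'I_s) (A : {set 'I_n}) : bool :=
  [forall x : config n s, forall y : config n s,
    [forall j in A, x j == y j] ==> (h x == h y)].

Definition agree_off n s (j : 'I_n) (x y : config n s) : bool :=
  [forall k, (k != j) ==> (x k == y k)].

Definition nondecr_in n s (h : config n s -> 'I_s) (j : 'I_n) : bool :=
  [forall x : config n s, forall y : config n s,
    agree_off j x y ==> (x j <= y j)%N ==> (h x <= h y)%N].

Definition nonincr_in n s (h : config n s -> 'I_s) (j : 'I_n) : bool :=
  [forall x : config n s, forall y : config n s,
    agree_off j x y ==> (x j <= y j)%N ==> (h y <= h x)%N].

Definition F n (D : sdigraph n) (s : nat) :
    {set {ffun config n s -> config n s}} :=
  [set f : {ffun config n s -> config n s} | [forall i,
    [&& depends_on (fun x => f x i) (in_nbr D i),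
        [forall j in nbr D 1 i, nondecr_in (fun x => f x i) j] &
        [forall j in nbr D (-1) i, nonincr_in (fun x => f x i) j]]]].

Definition Fix n s (f : {ffun config n s -> config n s}) :
    {set config n s} :=
  [set x | f x == x].

(** Extended-real valued: the logarithm of 0 is -oo, which is also the neutral
    element of the maximum in [g]. *)
Definition logs (R : realType) (s k : nat) : \bar R :=
  (lne k%:R%:E / lne s%:R%:E)%E.

Definition g (R : realType) n (D : sdigraph n) (s : nat) : \bar R :=
  \big[maxe/-oo%E]_(f in F D s) logs R s #|Fix f|.

Definition L n s (x y : config n s) : nat := #|[set i | (x i < y i)%N]|.

Definition dH n s (x y : config n s) : nat := (L x y + L y x)%N.
Definition dM n s (x y : config n s) : nat := maxn (L x y) (L y x).
Definition dm n s (x y : config n s) : nat := minn (L x y) (L y x).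

(** The minimum distance is rational so that half-integers are allowed. *)
Definition is_code n s (mu : config n s -> config n s -> nat) (d : rat)
    (C : {set config n s}) : bool :=
  [forall c in C, forall c' in C, (c != c') ==> (d <= (mu c c')%:R)].

Definition code_max n s (mu : config n s -> config n s -> nat) (d : rat) : nat :=
  \max_(C : {set config n s} | is_code mu d C) #|C|.

Definition AH (n : nat) (d : rat) (s : nat) : nat := code_max (@dH n s) d.
Definition AM (n : nat) (d : rat) (s : nat) : nat := code_max (@dM n s) d.
Definition Am (n : nat) (d : rat) (s : nat) : nat := code_max (@dm n s) d.

(* Main.v *)
Require Import Defs.
From mathcomp Require Import all_boot all_order all_algebra.
From mathcomp Require Import all_classical all_reals all_analysis.
Set Implicit Arguments.
Unset Strict Implicit.
Unset Printing Implicit Defensive.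
Import Order.TTheory GRing.Theory Num.Theory.
Local Open Scope ring_scope.

(** Let [x] and [y] be distinct fixed points of [f], and give the vertex [i] the
    sign [e_i] of [y_i - x_i].  If [e_i <> 0], monotonicity of [f_i] forces an
    arc [(j, i)] of sign [l] with [e_j <> 0] and [l * e_j * e_i >= 0].  Following
    such arcs backwards closes a cycle inside the support of [e]; since each
    [e_j] occurs twice in the product of the [l * e_j * e_i], the cycle is
    non-negative.  On it [e] is constant when all arcs are positive, and
    alternates when all arcs are negative. *)

(** * Cycles of finite relations *)

Lemma exists_ucycle_in (T : finType) (e : rel T) (P : {pred T}) (x : T) :
  x \in P -> (forall i, i \in P -> exists2 j, j \in P & e j i) ->
  exists c : seq T, [/\ c != [::], ucycleb e c & {subset c <= P}].
Proof.
move=> xP predP.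
pose p i := odflt i [pick j in P | e j i].
have pP i : i \in P -> p i \in P /\ e (p i) i.
  move=> iP; rewrite /p; case: pickP => [j /andP[] //|none].
  by have [j jP eji] := predP i iP; move: (none j); rewrite /= jP eji.
have itP k z : z \in P -> iter k p z \in P.
  by move=> zP; elim: k => //= k IHk; case: (pP _ IHk).
(* The iterates of the chosen predecessor map [p] eventually repeat. The first repeated value [z]
   lies on a loop of [p], whose orbit stays in [P]. *)
have /trajectP[m lt_m eq_m] := looping_order p x.
set z := iter m p x.
have zP : z \in P by apply: itP.
have fc : fcycle p (orbit p z).
  apply/(orbitPcycle 0 3); exists (order p x - m).-1.
  by rewrite prednK ?subn_gt0 // /z -iterD subnK ?eq_m // ltnW.
have oP : {subset orbit p z <= P}.
  by move=> w; rewrite -fconnect_orbit => /iter_findex <-; apply: itP.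
(* Applying [p] walks against the arcs of [e], so the orbit is read backwards. *)
exists (rev (orbit p z)); split.
- by rewrite -size_eq0 size_rev size_orbit -lt0n order_gt0.
- rewrite /ucycleb rev_cycle rev_uniq orbit_uniq andbT.
  apply: (sub_in_cycle (P := mem P)) fc; last by apply/allP.
  by move=> i j iP _ /eqP <-; case: (pP i iP).
- by move=> w; rewrite mem_rev => /oP.
Qed.

(** On a duplicate-free list [next c] is injective, with inverse [prev c]. This allows products and
    counts over a cycle to be reindexed by one step. *)
Lemma perm_map_next (T : eqType) (c : seq T) :
  uniq c -> perm_eq (map (next c) c) c.
Proof.
move=> uc; have um : uniq (map (next c) c).
  by rewrite map_inj_uniq //; apply: can_inj (prev_next uc).
apply: uniq_perm => // z; apply/mapP/idP => [[w wc ->]|zc].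
  by rewrite mem_next.
by exists (prev c z); rewrite ?mem_prev // next_prev.
Qed.

Lemma count_le_card (T : finType) (a : pred T) (c : seq T) :
  uniq c -> (count a c <= #|[set i | a i]|)%N.
Proof.
move=> uc; rewrite -size_filter -(card_uniqP (filter_uniq a uc)).
by apply/subset_leq_card/fintype.subsetP => i; rewrite mem_filter inE => /andP[].
Qed.

(** * Coherent cycles between two fixed points *)

Section FixedPoints.
Context {n s : nat} {D : sdigraph n}.
Context {f : {ffun config n s -> config n s}} (fF : f \in F D s).
Implicit Types x y : config n s.

(** The coordinates are changed from [x] to [y] one at a time, and no single change can decrease the
    value of [f] at [i]. *)
Lemma F_le x y (i : 'I_n) :
  (forall j, j \in nbr D 1 i -> (x j <= y j)%N) ->
  (forall j, j \in nbr D (-1) i -> (y j <= x j)%N) ->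
  (forall j, j \in nbr D 0 i -> x j = y j) ->
  (f x i <= f y i)%N.
Proof.
move=> pos neg zero.
move: fF; rewrite inE => /fintype.forallP /(_ i) /and3P[].
move=> /fintype.forallP dep /forall_inP mono /forall_inP anti.
(* [z k] takes its first [k] coordinates from [y] and the others from [x], so [z k] and [z k.+1] can
   differ only at [k]. *)
pose z k : config n s := [ffun j : 'I_n => if (j < k)%N then y j else x j].
have z_step (k : 'I_n) : (f (z k) i <= f (z k.+1) i)%N.
  have zk : z k k = x k by rewrite ffunE ltnn.
  have zk1 : z k.+1 k = y k by rewrite ffunE ltnSn.
  have off j : j != k -> z k j = z k.+1 j.
    by rewrite -val_eqE /= !ffunE ltnS [(j <= k)%N]leq_eqVlt => /negbTE ->.
  have ag : agree_off k (z k) (z k.+1).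
    by apply/fintype.forallP => j; apply/implyP => /off ->.
  have ag' : agree_off k (z k.+1) (z k).
    by apply/fintype.forallP => j; apply/implyP => /off ->.
  have [k1|k1] := boolP (k \in nbr D 1 i).
    move/fintype.forallP: (mono k k1) => /(_ (z k)) /fintype.forallP /(_ (z k.+1)).
    by rewrite ag zk zk1 pos.
  have [kN|kN] := boolP (k \in nbr D (-1) i).
    move/fintype.forallP: (anti k kN) => /(_ (z k.+1)) /fintype.forallP /(_ (z k)).
    by rewrite ag' zk zk1 neg.
  (* Either [k] is outside [in_nbr D i], or its arc has sign 0 and [x k = y k]; in both cases [z k]
     and [z k.+1] agree on [in_nbr D i]. *)
  have : f (z k) i == f (z k.+1) i.
    have /fintype.forallP /(_ (z k.+1)) /implyP := dep (z k); apply.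
    apply/forall_inP => j jN; have [jk|/off -> //] := eqVneq j k.
    rewrite jk zk zk1 zero //.
    by move: jN; rewrite jk !inE in k1 kN *; rewrite (negbTE k1) (negbTE kN) orbF.
  by move/eqP ->.
have z0 : z 0 = x by apply/ffunP => j; rewrite ffunE.
have zn : z n = y by apply/ffunP => j; rewrite ffunE ltn_ord.
suff H k : (k <= n)%N -> (f (z 0) i <= f (z k) i)%N
  by move: (H n (leqnn n)); rewrite z0 zn.
elim: k => // k IHk lt_kn.
exact: leq_trans (IHk (ltnW lt_kn)) (z_step (Ordinal lt_kn)).
Qed.

Definition diff_sign x y (i : 'I_n) : int := Num.sg ((y i)%:Z - (x i)%:Z).

Lemma diff_signC x y i : diff_sign y x i = - diff_sign x y i.
Proof. by rewrite /diff_sign -opprB sgrN. Qed.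

Lemma diff_sign_eq1 x y i : (diff_sign x y i == 1) = (x i < y i)%N.
Proof. by rewrite sgr_cp0 subr_gt0 ltz_nat. Qed.

Lemma diff_sign_eqN1 x y i : (diff_sign x y i == -1) = (y i < x i)%N.
Proof. by rewrite sgr_cp0 subr_lt0 ltz_nat. Qed.

Lemma diff_signP x y i :
  x i != y i -> diff_sign x y i = 1 \/ diff_sign x y i = -1.
Proof.
rewrite -val_eqE /= neq_ltn => /orP[].
  by rewrite -diff_sign_eq1 => /eqP; left.
by rewrite -diff_sign_eqN1 => /eqP; right.
Qed.

Definition coherent_arc x y : rel 'I_n := fun j i =>
  Defs.arc D j i && (0 <= sign D j i * (diff_sign x y j * diff_sign x y i)).

Lemma coherent_arcC x y : coherent_arc y x =2 coherent_arc x y.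
Proof. by move=> j i; rewrite /coherent_arc !(diff_signC x y) mulrNN. Qed.

(** Otherwise every change from [x] to [y] at an in-neighbour of [i] would push [f] at [i]
    downwards, so [F_le] with [x] and [y] exchanged would give [y i <= x i]. *)
Lemma exists_coherent_arc_lt x y (i : 'I_n) :
  x \in Fix f -> y \in Fix f -> (x i < y i)%N ->
  exists2 j, x j != y j & coherent_arc x y j i.
Proof.
rewrite !inE => /eqP fx /eqP fy lt_xy.
have [/existsP[j /andP[]]|] :=
  boolP [exists j, (x j != y j) && coherent_arc x y j i]; first by exists j.
rewrite negb_exists => /fintype.forallP none; exfalso.
have ei : diff_sign x y i = 1 by apply/eqP; rewrite diff_sign_eq1.
move: lt_xy; rewrite -[in X in (X < _)%N]fx -[in X in (_ < X)%N]fy ltnNge => /negP; apply.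
have no_arc j : Defs.arc D j i -> x j != y j -> sign D j i * diff_sign x y j < 0.
  move=> aji nxy; move: (none j).
  by rewrite nxy /coherent_arc aji ei mulr1 /= -ltNge.
apply: F_le => j; rewrite inE => /andP[aji /eqP sji].
- rewrite leqNgt; apply/negP => xy.
  have := no_arc j aji; rewrite -val_eqE /= (ltn_eqF xy) sji => /(_ isT).
  by move: xy; rewrite -diff_sign_eq1 => /eqP ->.
- rewrite leqNgt; apply/negP => xy.
  have := no_arc j aji; rewrite -val_eqE /= (gtn_eqF xy) sji => /(_ isT).
  by move: xy; rewrite -diff_sign_eqN1 => /eqP ->.
- apply/esym/eqP; rewrite -[_ == _]negbK; apply/negP => /(no_arc j aji).
  by rewrite sji mul0r ltxx.
Qed.

Lemma exists_coherent_arc x y (i : 'I_n) :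
  x \in Fix f -> y \in Fix f -> x i != y i ->
  exists2 j, x j != y j & coherent_arc x y j i.
Proof.
move=> fx fy; rewrite -val_eqE /= neq_ltn => /orP[|lt_yx].
  exact: exists_coherent_arc_lt.
have [j nj ej] := exists_coherent_arc_lt fy fx lt_yx.
by exists j; rewrite 1?eq_sym // -coherent_arcC.
Qed.

Lemma coherent_cycle_nonneg x y (c : seq 'I_n) :
  c != [::] -> ucycleb (coherent_arc x y) c ->
  {in c, forall i, x i != y i} -> nonneg_cycle D c.
Proof.
move=> c0 /andP[ec uc] dc.
have ac : cycle (Defs.arc D) c by apply: sub_cycle ec => i j /andP[].
rewrite /nonneg_cycle /dicycle /ucycleb c0 ac uc /=.
(* Reindexing by [next c] turns this product into the square of a product of signs 1 and -1; it can
   then be inserted into [cycle_sign D c]. *)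
have prod_sq : \prod_(i <- c) (diff_sign x y i * diff_sign x y (next c i)) = 1.
  have eq_next : \prod_(i <- c) diff_sign x y (next c i) =
                 \prod_(i <- c) diff_sign x y i.
    by rewrite -[RHS](perm_big _ (perm_map_next uc)) big_map.
  rewrite big_split /= eq_next -big_split big_seq big1 //= => i ic.
  by case: (diff_signP (dc i ic)) => ->.
have -> : cycle_sign D c =
    \prod_(i <- c) (sign D i (next c i)
                    * (diff_sign x y i * diff_sign x y (next c i))).
  by rewrite [RHS]big_split prod_sq [RHS]mulr1.
by rewrite big_seq; apply: prodr_ge0 => i /(next_cycle ec) /andP[].
Qed.

Lemma exists_coherent_cycle x y :
  x \in Fix f -> y \in Fix f -> x <> y ->
  exists c, [/\ nonneg_cycle D c, ucycleb (coherent_arc x y) c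
              & {in c, forall i, x i != y i}].
Proof.
move=> fx fy nxy.
have [i ni] : exists i, x i != y i.
  apply/existsP; rewrite -negb_forall; apply/negP => /fintype.forallP e.
  by apply: nxy; apply/ffunP => i; apply/eqP.
have [|c [c0 ec dc]] :=
    @exists_ucycle_in _ (coherent_arc x y) [pred i | x i != y i] i ni.
  by move=> k nk; apply: exists_coherent_arc.
by exists c; split; [apply: (coherent_cycle_nonneg c0 ec dc) | exact: ec | exact: dc].
Qed.

End FixedPoints.

(** * Distance bounds for distinct fixed points *)

Section Girth.
Context {n s : nat} {D : sdigraph n} (hD : exists c, nonneg_cycle D c).
Context {f : {ffun config n s -> config n s}} (fF : f \in F D s).
Context {x y : config n s} (fx : x \in Fix f) (fy : y \in Fix f) (nxy : x <> y).

Lemma nonneg_girth_le (c : seq 'I_n) :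
  nonneg_cycle D c -> (nonneg_girth hD <= size c)%N.
Proof.
move=> nc; rewrite /nonneg_girth; case: ex_minnP => m _; apply.
by apply/existsP; exists (in_tuple c).
Qed.

Lemma size_count_diff (c : seq 'I_n) : {in c, forall i, x i != y i} ->
  size c = (count (fun i => x i < y i)%N c + count (fun i => y i < x i)%N c)%N.
Proof.
move=> dc; rewrite -(count_predC (fun i => x i < y i)%N); congr addn.
apply: eq_in_count => i /dc /=.
by rewrite -leqNgt -val_eqE /= ltn_neqAle eq_sym => ->.
Qed.

Lemma girth_le_dH : (nonneg_girth hD <= dH x y)%N.
Proof.
have [c [nc /andP[_ uc] dc]] := exists_coherent_cycle fF fx fy nxy.
apply: leq_trans (nonneg_girth_le nc) _.
by rewrite (size_count_diff dc) leq_add // count_le_card.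
Qed.

Lemma girth_le_dM : positive D -> (nonneg_girth hD <= dM x y)%N.
Proof.
move=> posD; have [c [nc /andP[ec uc] dc]] := exists_coherent_cycle fF fx fy nxy.
apply: leq_trans (nonneg_girth_le nc) _.
have eqc : cycle (relpre (diff_sign x y) eq_op) c.
  apply: (sub_in_cycle (P := mem c)) ec; last exact/allP.
  move=> i j /dc/diff_signP ei /dc/diff_signP ej /andP[aij].
  by rewrite (posD _ _ aij) /=; case: ei => ->; case: ej => ->.
have [e ce] : exists e, {in c, forall i, diff_sign x y i = e}.
  (* The value 0 is a dummy for the empty list. Otherwise transitivity along the closed path
     compares every vertex with [a]. *)
  case: (c) eqc => [|a p /= pe]; first by exists 0.
  exists (diff_sign x y a) => i ip.
  have tr : transitive (relpre (diff_sign x y) eq_op).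
    by move=> u v w /= /eqP -> /eqP ->.
  have /allP /(_ i) := order_path_min tr pe.
  by rewrite mem_rcons => /(_ ip) /eqP.
have all_c (P : pred 'I_n) : all P c -> (size c <= #|[set i | P i]|)%N.
  by rewrite all_count => /eqP <-; apply: count_le_card.
have [a ac] : exists a, a \in c.
  by case: (c) nc => [//|a p] _; exists a; apply: mem_head.
rewrite /dM leq_max; apply/orP.
have [e1|eN1] := diff_signP (dc a ac); [left|right].
  by apply/all_c/allP => i ic; rewrite -diff_sign_eq1 ce // -(ce a ac) e1.
by apply/all_c/allP => i ic; rewrite -diff_sign_eqN1 ce // -(ce a ac) eN1.
Qed.

Lemma girth_le_dm : negative D -> (nonneg_girth hD <= (dm x y).*2)%N.
Proof.
move=> negD; have [c [nc /andP[ec uc] dc]] := exists_coherent_cycle fF fx fy nxy.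
apply: leq_trans (nonneg_girth_le nc) _.
(* Along a coherent negative arc the difference changes sign, so [next c] matches the vertices where
   [y] is smaller with those where [y] is larger. *)
have eq_count : count (fun i => x i < y i)%N c = count (fun i => y i < x i)%N c.
  rewrite -(permP (perm_map_next uc)) count_map; apply: eq_in_count => i ic /=.
  have /andP[ai] := next_cycle ec ic.
  rewrite -diff_sign_eq1 -diff_sign_eqN1 (negD _ _ ai).
  have ic' : next c i \in c by rewrite mem_next.
  by case: (diff_signP (dc _ ic)) => ->; case: (diff_signP (dc _ ic')) => ->.
rewrite (size_count_diff dc) -eq_count addnn leq_double /dm leq_min.
by rewrite {2}eq_count !count_le_card.
Qed.

End Girth.

(** * From distances to code sizes *)

Lemma le_logs (R : realType) (s : nat) :
  (2 <= s)%N -> {homo logs R s : k m / (k <= m)%N >-> (k <= m)%E}.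
Proof.
move=> s2 k m km.
rewrite /logs; apply: lee_wpmul2r.
  by rewrite inve_ge0 lne_ge0 lee_fin ler1n ltnW.
(* Monotonicity of [lne] is used on the nonnegative extended reals, so [k = 0] is covered. *)
by rewrite lee_lne ?lee_fin ?ler_nat // in_itv /= lee_fin ler0n leey.
Qed.

(** Under the distance hypothesis each [Fix f] is itself a code, hence one of the sets over which
    [code_max] is taken. *)
Lemma g_le_code_max (R : realType) n (D : sdigraph n) (s : nat) mu (d : rat) :
  (2 <= s)%N ->
  (forall f x y, f \in F D s -> x \in Fix f -> y \in Fix f -> x <> y ->
     d <= (mu x y)%:R) ->
  (g R D s <= logs R s (code_max mu d))%E.
Proof.
move=> s2 dist; apply: bigmax_le => [|f fF]; first exact: leNye.
apply: le_logs s2 _ _ _; apply: leq_bigmax_cond.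
apply/forall_inP => x xf; apply/forall_inP => y yf; apply/implyP => /eqP nxy.
exact: (dist f).
Qed.

Theorem theorem4 (R : realType) (n : nat) (D : sdigraph n)
    (hD : exists c : seq 'I_n, nonneg_cycle D c) (s : nat) (hs : (2 <= s)%N) :
  [/\ forall f : {ffun config n s -> config n s}, f \in F D s ->
        forall x y : config n s, x \in Fix f -> y \in Fix f -> x <> y ->
          (nonneg_girth hD <= dH x y)%N,
      (g R D s <= logs R s (AH n (nonneg_girth hD)%:R s))%E,
      negative D ->
        (g R D s <= logs R s (Am n ((nonneg_girth hD)%:R / 2) s))%E
    & positive D ->
        (g R D s <= logs R s (AM n (nonneg_girth hD)%:R s))%E].
Proof.
split=> [f fF x y xf yf nxy||negD|posD].
- exact: (girth_le_dH hD fF xf yf nxy).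
- apply: g_le_code_max => // f x y fF xf yf nxy.
  by rewrite ler_nat (girth_le_dH hD fF xf yf nxy).
- apply: g_le_code_max => // f x y fF xf yf nxy.
  (* Clearing the denominator leaves the bound by twice [dm x y]. *)
  rewrite ler_pdivrMr // -natrM ler_nat muln2.
  exact: (girth_le_dm hD fF xf yf nxy negD).
- apply: g_le_code_max => // f x y fF xf yf nxy.
  by rewrite ler_nat (girth_le_dM hD fF xf yf nxy posD).
Qed.
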